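(* Let $F$ and $G$ be two graphs and $v\in V(G)$. Then the graph $G_v[F]$ obtained by substituting $F$ for $v$ in $G$ is CDC if and only if $F$ and $G$ are both CDC.
   Context: All graphs are finite, simple, undirected, with nonempty vertex set. Given graphs $F$ and $G$ and a vertex $v\in V(G)$, substituting $F$ for $v$ in $G$ yields the graph $G_v[F]$ obtained from the disjoint union of $G-v$ and $F$ by adding all edges joining a vertex of $N_G(v)$ (the set of neighbors of $v$ in $G$) with a vertex of $F$. A clique is a set of pairwise adjacent vertices; it is maximal if it is not contained in a larger clique. A clique transversal of a graph is a set of vertices containing at least one vertex from each maximal clique; it is minimal if it contains no smaller clique transversal. A hypergraph is a pair $(V,E)$ with $V$ a finite set and $E$ a set of subsets of $V$ (hyperedges) such that every vertex belongs to a hyperedge; it is conformal if every set of vertices such that any two of them belong to a common hyperedge is itself contained in a hyperedge. A graph $G$ is clique dually conformal (CDC) if the hypergraph with vertex set $V(G)$ whose hyperedges are the minimal clique transversals of $G$ is conformal. *)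

(* Defs.v *)
From mathcomp Require Import all_boot.

Set Implicit Arguments.
Unset Strict Implicit.
Unset Printing Implicit Defensive.

Record sgraph : Type := SGraph {
  vertex :> finType;
  edge : rel vertex;
  edge_sym : symmetric edge;
  edge_irrefl : irreflexive edge;
  vertex_gt0 : 0 < #|vertex|
}.

Notation "x -- y" := (edge x y) (at level 30, no associativity).

Section Substitution.
Variables (F G : sgraph) (v : G).

(* The disjoint union of V(G) minus v and V(F). *)
Definition subst_vertex : finType := ({u : G | u != v} + F)%type.

Definition subst_edge : rel subst_vertex := fun x y =>
  match x, y with
  | inl a, inl b => val a -- val b
  | inl a, inr _ => val a -- v
  | inr _, inl b => val b -- v
  | inr a, inr b => a -- b
  end.

Lemma subst_edge_sym : symmetric subst_edge.
Proof. by move=> [a|a] [b|b] //=; rewrite edge_sym. Qed.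

Lemma subst_edge_irrefl : irreflexive subst_edge.
Proof. by case=> a; exact: edge_irrefl. Qed.

Lemma subst_vertex_gt0 : 0 < #|subst_vertex|.
Proof. by rewrite card_sum addn_gt0 vertex_gt0 orbT. Qed.

Definition substitute : sgraph :=
  SGraph subst_edge_sym subst_edge_irrefl subst_vertex_gt0.

End Substitution.

Record hypergraph : Type := Hypergraph {
  hvertex : finType;
  hyperedges : {set {set hvertex}};
  hyperedges_cover : forall x : hvertex, exists2 e, e \in hyperedges & x \in e
}.

Definition conformal (H : hypergraph) : Prop :=
  forall S : {set hvertex H},
    {in S &, forall x y, x != y ->
       exists2 e, e \in hyperedges H & (x \in e) && (y \in e)} ->
    exists2 e, e \in hyperedges H & S \subset e.

Section CliqueTransversals.
Variable G : sgraph.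

Definition clique (K : {set G}) : bool :=
  [forall x in K, forall y in K, (x != y) ==> x -- y].

Definition maximal_clique (K : {set G}) : bool := maxset clique K.

Definition clique_transversal (T : {set G}) : bool :=
  [forall K : {set G}, maximal_clique K ==> (T :&: K != set0)].

Definition minimal_clique_transversal (T : {set G}) : bool :=
  minset clique_transversal T.

Lemma minimal_clique_transversal_cover (x : G) :
  exists2 T, T \in [set T | minimal_clique_transversal T] & x \in T.
Proof.
have cl1 : clique [set x].
  apply/forall_inP => a /set1P ->; apply/forall_inP => b /set1P ->.
  by rewrite eqxx.
have [C maxC] := maxset_exists cl1; rewrite sub1set => xC.
(* C minus x contains no maximal clique, so its complement is a transversal,
   and a minimal transversal inside it can meet C only in x. *)
have trT : clique_transversal (~: (C :\ x)).
  apply/forall_inP => K maxK; apply/eqP => tK0.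
  have sKC : K \subset C :\ x.
    by rewrite -[C :\ x]setCK -disjoints_subset -setI_eq0 setIC tK0.
  have eKC : C = K.
    by apply: (maxsetsup maxK (maxsetp maxC)); apply: subset_trans sKC (subD1set _ _).
  by move: sKC; rewrite -eKC => /subsetP /(_ x xC); rewrite !inE eqxx.
have [T minT sT] := minset_exists trT.
exists T; first by rewrite inE.
have /set0Pn[y] : T :&: C != set0 by move/forall_inP: (minsetp minT); apply.
rewrite inE => /andP[yT yC]; move/subsetP/(_ y yT): sT.
by rewrite !inE yC andbT negbK => /eqP <-.
Qed.

Definition clique_transversal_hypergraph : hypergraph :=
  Hypergraph minimal_clique_transversal_cover.

End CliqueTransversals.

Definition CDC (G : sgraph) : Prop :=
  conformal (clique_transversal_hypergraph G).

(* Main.v *)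
Require Import Defs.
From mathcomp Require Import all_boot.

Set Implicit Arguments.
Unset Strict Implicit.
Unset Printing Implicit Defensive.

(** Write H for the graph obtained by substituting F for v in G.  Collapsing
    the copy of F to v gives a projection from H onto G, and a set A of vertices
    of G together with a set B of vertices of F determine the set of vertices
    of H that replaces v, if v is in A, by B (blowup A B below).

    The point of the proof is that one and the same operation describes both
    the cliques and their transversals:
    - the maximal cliques of H are the sets blowup K L, with K and L maximal
      cliques of G and F (maximal_clique_substituteP);
    - the minimal clique transversals of H are the sets blowup Q P, with Q and
      P minimal clique transversals of G and F
      (minimal_clique_transversal_substituteP).
    The second fact follows from the first.  If a transversal T of H restricts
    to a transversal of F, then T contains the blowup of its projection by its
    restriction; otherwise T misses a maximal clique L of F, so that the part
    of T outside F already has to meet all maximal cliques of G.  Maximality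
    and minimality are transferred by one monotonicity property: a blowup of A
    by a nonempty set determines A, and it determines B as soon as v is in A
    (blowup_subset).

    Once the hyperedges of H are known to be the blowups of those of G and F,
    conformality is formal.  Two vertices of H that share a hyperedge have
    projections that share one, and so do their restrictions to F, hence
    hyperedges Q and P that cover these two shadows of a set S give a hyperedge
    blowup Q P that covers S.  Conversely F, and G with v represented by a
    vertex of F, sit inside H in a way that preserves and reflects sharing a
    hyperedge. *)

(** * Cliques and transversals in one graph *)

Section OneGraph.
Variable G : sgraph.
Implicit Types (x y : G) (K T : {set G}).

Lemma cliqueP K :
  reflect {in K &, forall x y, x != y -> x -- y} (clique K).
Proof.
apply: (iffP forall_inP) => [cK x y xK yK xy | cK x xK].
  by move/forall_inP/(_ y yK)/implyP: (cK x xK); apply.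
by apply/forall_inP => y yK; apply/implyP; apply: cK.
Qed.

Lemma clique_transversalP T :
  reflect (forall K, maximal_clique K -> exists2 x, x \in T & x \in K)
          (clique_transversal T).
Proof.
apply: (iffP forall_inP) => tT K /tT.
  by case/set0Pn=> x /setIP[]; exists x.
by case=> x xT xK; apply/set0Pn; exists x; apply/setIP.
Qed.

Lemma vertex_exists : exists x : G, true.
Proof. by have /card_gt0P[x _] := vertex_gt0 G; exists x. Qed.

Lemma maximal_clique_exists : exists K, maximal_clique K.
Proof.
have c0 : clique (set0 : {set G}) by apply/cliqueP => x y; rewrite inE.
by have [K maxK _] := maxset_exists c0; exists K.
Qed.

Lemma clique_transversal_nonempty T :
  clique_transversal T -> exists x, x \in T.
Proof.
have [K maxK] := maximal_clique_exists.
by move/clique_transversalP/(_ K maxK) => [x xT _]; exists x.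
Qed.

(** Every graph has a clique transversal, and it has to meet the clique. *)
Lemma maximal_clique_nonempty K : maximal_clique K -> exists x, x \in K.
Proof.
have [x _] := vertex_exists.
have [T + _] := minimal_clique_transversal_cover x.
rewrite inE => /minsetp/clique_transversalP tT /tT[y _ yK].
by exists y.
Qed.

Lemma CDC_cover (S : {set G}) :
  CDC G ->
  {in S &, forall x y, x != y ->
     exists2 T, minimal_clique_transversal T & (x \in T) && (y \in T)} ->
  exists2 T, minimal_clique_transversal T & S \subset T.
Proof.
move=> cdcG coS; have [|T] := cdcG S; last by rewrite inE; exists T.
by move=> x y xS yS /(coS x y xS yS)[T minT xyT]; exists T; rewrite ?inE.
Qed.

Lemma in_minimal_clique_transversal x :
  exists2 T, minimal_clique_transversal T & x \in T.
Proof.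
have [T + xT] := minimal_clique_transversal_cover x.
by rewrite inE; exists T.
Qed.

End OneGraph.

(** * Blowups *)

Section Blowup.
Variables (F G : sgraph) (v : G).
Local Notation H := (substitute F v).
Implicit Types (x y : H) (A K Q : {set G}) (B L P : {set F}) (X T : {set H}).

Definition collapse (x : H) : G := if x is inl a then val a else v.

Definition blowup A B : {set H} :=
  [set x | (collapse x \in A) && (if x is inr f then f \in B else true)].

Definition trace X : {set F} := [set f | (inr f : H) \in X].

Lemma in_blowupl A B u : ((inl u : H) \in blowup A B) = (val u \in A).
Proof. by rewrite inE andbT. Qed.

Lemma in_blowupr A B f : ((inr f : H) \in blowup A B) = (v \in A) && (f \in B).
Proof. by rewrite inE. Qed.

Lemma collapse_blowup A B x : x \in blowup A B -> collapse x \in A.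
Proof. by rewrite inE => /andP[]. Qed.

Lemma collapse_inl x (u : {u : G | u != v}) :
  collapse x = val u -> x = inl u.
Proof.
case: x => [w /val_inj -> // | f /= vu].
by move: (valP u); rewrite /= -vu eqxx.
Qed.

Lemma adjacent_collapse x y :
  collapse x != collapse y -> x -- y = collapse x -- collapse y.
Proof.
case: x y => [a|f] [b|g] //=; last by rewrite eqxx.
by rewrite edge_sym.
Qed.

(** A section of the projection onto G, with a vertex f standing for v. *)
Definition expand (f : F) (a : G) : H :=
  if insub a is Some u then inl u else inr f.

Lemma expandK f : cancel (expand f) collapse.
Proof.
move=> a; rewrite /expand.
by case: insubP => [u _ //|] /=; rewrite negbK => /eqP ->.
Qed.

Lemma expand_blowup A B f a : f \in B -> (expand f a \in blowup A B) = (a \in A).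
Proof.
move=> fB; rewrite inE expandK /expand.
by case: insubP => [u|] *; rewrite ?fB andbT.
Qed.

Lemma blowupS A A' B B' :
  A \subset A' -> B \subset B' -> blowup A B \subset blowup A' B'.
Proof.
move=> /subsetP sA /subsetP sB; apply/subsetP => -[u|f].
  by rewrite !in_blowupl; apply: sA.
by rewrite !in_blowupr => /andP[/sA -> /sB].
Qed.

(** Nonemptiness of B, witnessed by f, makes the presence of v in A visible in the blowup. *)
Lemma blowup_subset A A' B B' f :
  f \in B -> blowup A B \subset blowup A' B' ->
  A \subset A' /\ (v \in A -> B \subset B').
Proof.
move=> fB /subsetP sAB; split=> [|vA].
  apply/subsetP => a aA; rewrite -(expandK f a).
  by apply: (@collapse_blowup _ B'); apply: sAB; rewrite expand_blowup.
apply/subsetP => g gB; have := sAB (inr g).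
by rewrite !in_blowupr vA gB => /(_ isT)/andP[].
Qed.

(** If v is not in A, then B leaves no mark on the blowup. *)
Lemma eq_blowup A B B' : (v \in A -> B = B') -> blowup A B = blowup A B'.
Proof.
move=> eqB; apply/setP => -[u|f]; first by rewrite !in_blowupl.
by rewrite !in_blowupr; case: (boolP (v \in A)) => // /eqB ->.
Qed.

(** * Maximal cliques of the substituted graph *)

Lemma clique_blowup K L : clique K -> clique L -> clique (blowup K L).
Proof.
move=> /cliqueP cK /cliqueP cL; apply/cliqueP => x y xKL yKL xy.
have [eq_xy|neq_xy] := eqVneq (collapse x) (collapse y); last first.
  by rewrite adjacent_collapse // cK // (@collapse_blowup _ L).
(* Distinct vertices with equal projections lie in the copy of F. *)
case: x y eq_xy xKL yKL xy => [u|f] y eq_xy.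
  by rewrite (collapse_inl (esym eq_xy)) eqxx.
case: y eq_xy => [w /collapse_inl // | g _].
rewrite !in_blowupr => /andP[_ fL] /andP[_ gL] fg.
by apply: cL => //; apply: contra_neq fg => ->.
Qed.

(** The projection and the trace of a clique are cliques, because an edge of
    the substituted graph is either collapsed or sent to an edge; both of them
    extend to maximal cliques. *)
Lemma clique_sub_blowup X :
  clique X -> exists K L,
    [/\ maximal_clique K, maximal_clique L & X \subset blowup K L].
Proof.
move=> /cliqueP cX.
have cK : clique (collapse @: X).
  apply/cliqueP => _ _ /imsetP[x xX ->] /imsetP[y yX ->] xy.
  by rewrite -adjacent_collapse // cX //; apply: contra_neq xy => ->.
have cL : clique (trace X).
  apply/cliqueP => f g; rewrite !inE => fX gX fg.
  by apply: (cX (inr f) (inr g)) => //; apply: contra_neq fg => -[].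
have [K maxK /subsetP sK] := maxset_exists cK.
have [L maxL /subsetP sL] := maxset_exists cL.
exists K, L; split=> //; apply/subsetP => x xX.
rewrite inE sK ?imset_f //=; case: x xX => // f fX.
by rewrite sL ?inE.
Qed.

(** Blowups of maximal cliques are cliques, and they are cofinal among the
    cliques; no two of them are properly nested, by monotonicity of the blowup
    in both arguments. *)
Lemma maximal_clique_substituteP X :
  maximal_clique X <-> exists K L,
    [/\ maximal_clique K, maximal_clique L & X = blowup K L].
Proof.
split=> [maxX | [K [L [maxK maxL ->]]]].
  have [K [L [maxK maxL sX]]] := clique_sub_blowup (maxsetp maxX).
  exists K, L; split=> //; apply/esym/(maxsetsup maxX) => //.
  exact: clique_blowup (maxsetp maxK) (maxsetp maxL).
apply/maxsetP; split=> [|Y cY sY].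
  exact: clique_blowup (maxsetp maxK) (maxsetp maxL).
have [K' [L' [maxK' maxL' sY']]] := clique_sub_blowup cY.
have [f fL] := maximal_clique_nonempty maxL.
have [sK sL] := blowup_subset fL (subset_trans sY sY').
have eqK := maxsetsup maxK (maxsetp maxK') sK.
suff eqKL : blowup K L = blowup K' L' by apply/eqP; rewrite eqEsubset sY eqKL sY'.
rewrite eqK; apply: eq_blowup => vK.
by apply/esym/(maxsetsup maxL (maxsetp maxL') (sL vK)).
Qed.

(** * Minimal clique transversals of the substituted graph *)

Lemma clique_transversal_blowup Q P :
  clique_transversal Q -> clique_transversal P ->
  clique_transversal (blowup Q P).
Proof.
move=> /clique_transversalP tQ /clique_transversalP tP.
apply/clique_transversalP => _ /maximal_clique_substituteP[K [L [maxK maxL ->]]].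
have [[a aQ aK] [f fP fL]] := (tQ K maxK, tP L maxL).
by exists (expand f a); rewrite expand_blowup.
Qed.

Lemma blowup_collapse_sub T Q P :
  Q \subset collapse @: T -> (v \in Q -> P \subset trace T) ->
  blowup Q P \subset T.
Proof.
move=> /subsetP sQ sP; apply/subsetP => -[u|f].
  rewrite in_blowupl => /sQ/imsetP[x xT /esym/collapse_inl eqx].
  by rewrite -eqx.
by rewrite in_blowupr => /andP[/sP/subsetP sPT /sPT]; rewrite inE.
Qed.

(** The case distinction decides whether v is used.  If the trace of T is a
    transversal of F, then v may be put into Q, since its blowup by the trace
    stays inside T.  If the trace misses a maximal clique L, then
    T meets each blowup of a maximal clique by L outside F, and Q can avoid v. *)
Lemma blowup_sub_clique_transversal T :
  clique_transversal T -> exists Q P,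
    [/\ minimal_clique_transversal Q, minimal_clique_transversal P
      & blowup Q P \subset T].
Proof.
move=> /clique_transversalP tT.
suff [Q [P [tQ tP sT]]] : exists Q P,
    [/\ clique_transversal Q, clique_transversal P & blowup Q P \subset T].
  have [[Q' minQ' sQ] [P' minP' sP]] := (minset_exists tQ, minset_exists tP).
  by exists Q', P'; split=> //; apply: subset_trans sT; apply: blowupS.
have meet K L : maximal_clique K -> maximal_clique L ->
    exists2 x, x \in T & x \in blowup K L.
  by move=> maxK maxL; apply: tT; apply/maximal_clique_substituteP; exists K, L.
have [tF|] := boolP (clique_transversal (trace T)).
  exists (collapse @: T), (trace T); split=> //; last exact: blowup_collapse_sub.
  apply/clique_transversalP => K maxK.
  have [L maxL] := maximal_clique_exists F.
  have [x xT /collapse_blowup xK] := meet K L maxK maxL.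
  by exists (collapse x); rewrite ?imset_f.
case/forall_inPn => L maxL; rewrite negbK => /eqP missL.
have [f _] := vertex_exists F.
have [P minP _] := in_minimal_clique_transversal f.
(* Without v the blowup does not depend on P. *)
exists (collapse @: T :\ v), P; split; last first.
- by apply: blowup_collapse_sub (subD1set _ _) _; rewrite setD11.
- exact: minsetp minP.
apply/clique_transversalP => K maxK; have [x xT xKL] := meet K L maxK maxL.
exists (collapse x); last exact: collapse_blowup xKL.
rewrite in_setD1 imset_f // andbT; case: x xT xKL => [u _ _ | g gT].
  exact: valP u.
rewrite in_blowupr => /andP[_ gL].
by have := in_set0 g; rewrite -missL !inE gT gL.
Qed.

(** The order dual of the argument for maximal cliques: blowups of minimal
    transversals are coinitial among the transversals. *)
Lemma minimal_clique_transversal_substituteP T :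
  minimal_clique_transversal T <-> exists Q P,
    [/\ minimal_clique_transversal Q, minimal_clique_transversal P
      & T = blowup Q P].
Proof.
split=> [minT | [Q [P [minQ minP ->]]]].
  have [Q [P [minQ minP sT]]] := blowup_sub_clique_transversal (minsetp minT).
  exists Q, P; split=> //; apply/esym/(minsetinf minT) => //.
  exact: clique_transversal_blowup (minsetp minQ) (minsetp minP).
apply/minsetP; split=> [|U tU sU].
  exact: clique_transversal_blowup (minsetp minQ) (minsetp minP).
have [Q' [P' [minQ' minP' sU']]] := blowup_sub_clique_transversal tU.
have [f fP'] := clique_transversal_nonempty (minsetp minP').
have [sQ sP] := blowup_subset fP' (subset_trans sU' sU).
have eqQ := minsetinf minQ (minsetp minQ') sQ.
suff eqQP : blowup Q' P' = blowup Q P by apply/eqP; rewrite eqEsubset sU -eqQP sU'.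
rewrite eqQ; apply: eq_blowup; rewrite -eqQ => vQ.
exact: minsetinf minP (minsetp minP') (sP vQ).
Qed.

(** * Conformality *)

(** The projection and the trace of S are covered separately.  If S has no
    vertex in F, then the trace is empty and the choice of P is harmless. *)
Lemma CDC_substitute : CDC F -> CDC G -> CDC H.
Proof.
move=> cdcF cdcG S coS.
have share x y : x \in S -> y \in S -> x != y -> exists Q P,
    [/\ minimal_clique_transversal Q, minimal_clique_transversal P,
        x \in blowup Q P & y \in blowup Q P].
  move=> xS yS /(coS x y xS yS)[T]; rewrite inE.
  by case/minimal_clique_transversal_substituteP=> [Q [P [? ? ->]]] /andP[]; exists Q, P.
have [|Q minQ /subsetP sQ] := CDC_cover (S := collapse @: S) cdcG.
  move=> _ _ /imsetP[x xS ->] /imsetP[y yS ->] xy.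
  have [|Q [P [minQ _ xQP yQP]]] := share x y xS yS.
    by apply: contra_neq xy => ->.
  by exists Q; rewrite ?(@collapse_blowup _ P).
have [|P minP /subsetP sP] := CDC_cover (S := trace S) cdcF.
  move=> f g; rewrite !inE => fS gS fg.
  have [|Q' [P [_ minP]]] := share _ _ fS gS; first by apply: contra_neq fg => -[].
  by rewrite !in_blowupr => /andP[_ fP] /andP[_ gP]; exists P; rewrite ?fP.
exists (blowup Q P).
  by rewrite inE; apply/minimal_clique_transversal_substituteP; exists Q, P.
apply/subsetP => x xS; rewrite inE sQ ?imset_f //=.
by case: x xS => // f fS; rewrite sP ?inE.
Qed.

Lemma CDC_substitute_cover (S : {set H}) :
  CDC H ->
  {in S &, forall x y, x != y -> exists Q P,
     [/\ minimal_clique_transversal Q, minimal_clique_transversal P,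
         x \in blowup Q P & y \in blowup Q P]} ->
  exists Q P, [/\ minimal_clique_transversal Q, minimal_clique_transversal P
                & S \subset blowup Q P].
Proof.
move=> cdcH coS; have [|T] := CDC_cover (S := S) cdcH; last first.
  by case/minimal_clique_transversal_substituteP=> [Q [P [? ? ->]]]; exists Q, P.
move=> x y xS yS /(coS x y xS yS)[Q [P [minQ minP xQP yQP]]].
exists (blowup Q P); last by rewrite xQP.
by apply/minimal_clique_transversal_substituteP; exists Q, P.
Qed.

(** A vertex f of F stands for v; all hyperedges Q of G are blown up by one
    fixed hyperedge through f, so that membership of v in Q is remembered. *)
Lemma CDC_substitute_outer : CDC H -> CDC G.
Proof.
move=> cdcH S coS; have [f _] := vertex_exists F.
have [P0 minP0 fP0] := in_minimal_clique_transversal f.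
have [|Q [P [minQ _ /subsetP sQP]]] := CDC_substitute_cover (S := expand f @: S) cdcH.
  move=> _ _ /imsetP[a aS ->] /imsetP[b bS ->] ab.
  have [|Q] := coS a b aS bS; first by apply: contra_neq ab => ->.
  by rewrite inE => minQ /andP[aQ bQ]; exists Q, P0; rewrite !expand_blowup.
exists Q; first by rewrite inE.
apply/subsetP => a aS; rewrite -(expandK f a).
by apply: (@collapse_blowup _ P); apply: sQP; rewrite imset_f.
Qed.

(** Blowing up one fixed hyperedge of G through v makes each hyperedge of F
    the trace of a hyperedge. *)
Lemma CDC_substitute_inner : CDC H -> CDC F.
Proof.
move=> cdcH S coS; have [Q0 minQ0 vQ0] := in_minimal_clique_transversal v.
have [|Q [P [_ minP /subsetP sQP]]] :=
    CDC_substitute_cover (S := [set (inr f : H) | f in S]) cdcH.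
  move=> _ _ /imsetP[f fS ->] /imsetP[g gS ->] fg.
  have [|P] := coS f g fS gS; first by apply: contra_neq fg => ->.
  by rewrite inE => minP /andP[fP gP]; exists Q0, P; rewrite !in_blowupr vQ0 fP gP.
exists P; first by rewrite inE.
apply/subsetP => f fS; have := sQP (inr f).
by rewrite in_blowupr imset_f // => /(_ isT)/andP[].
Qed.

End Blowup.

Theorem theorem5p5 (F G : sgraph) (v : G) :
  CDC (substitute F v) <-> CDC F /\ CDC G.
Proof.
split=> [cdcH | [cdcF cdcG]]; last exact: CDC_substitute.
by split; [exact: CDC_substitute_inner cdcH | exact: CDC_substitute_outer cdcH].
Qed.
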